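(* Let $0\le q\le n$ and $0\le r\le m$ be integers. Then $\operatorname{reg}(I_qJ_r)=q+r$.
   Context: Let $K$ be a field, $n,m\ge 0$ integers, and $S=K[x_1,\dots,x_n,y_1,\dots,y_m]$ the polynomial ring in $n+m$ variables with its standard grading. For $0\le k\le n$, $I_k\subseteq S$ is the ideal generated by all square-free monomials of degree $k$ in the variables $x_1,\dots,x_n$; for $0\le l\le m$, $J_l\subseteq S$ is the ideal generated by all square-free monomials of degree $l$ in the variables $y_1,\dots,y_m$. By convention $I_0=J_0=S$. For a finitely generated graded $S$-module $M\neq 0$ with minimal graded free resolution $0\to\bigoplus_i S(-d_{g,i})\to\cdots\to\bigoplus_i S(-d_{k,i})\to\cdots\to\bigoplus_i S(-d_{0,i})\to M\to 0$, the Castelnuovo-Mumford regularity is $\operatorname{reg}(M)=\max\{d_{k,i}-k : k\ge 0,\ i\}$. *)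

(* Defs.v *)
From HB Require Import structures.
From mathcomp Require Import all_boot all_order all_algebra.
From mathcomp Require Import mpoly.

Set Implicit Arguments.
Unset Strict Implicit.
Unset Printing Implicit Defensive.

Import Order.TTheory GRing.Theory Num.Theory.
Local Open Scope ring_scope.

Definition ideal_generated (R : comNzRingType) (G : R -> Prop) (f : R) : Prop :=
  exists (s : nat) (a g : 'I_s -> R),
    (forall i, G (g i)) /\ f = \sum_(i < s) a i * g i.

Definition ideal_product (R : comNzRingType) (I J : R -> Prop) : R -> Prop :=
  ideal_generated (fun h => exists f g, [/\ I f, J g & h = f * g]).

(* In {mpoly K[n + m]} the variables x_i are the 'X_(lshift m i), i < n, and the
   y_j are the 'X_(rshift n j), j < m. A square-free monomial of degree k is a
   product of k distinct variables; for k = 0 it is 1, so I_0 = J_0 = S. *)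
Definition sqfree_ideal_x (K : fieldType) (n m k : nat) :
    {mpoly K[n + m]} -> Prop :=
  ideal_generated (fun f =>
    exists2 A : {set 'I_n}, #|A| = k & f = \prod_(i in A) 'X_(lshift m i)).

Definition sqfree_ideal_y (K : fieldType) (n m l : nat) :
    {mpoly K[n + m]} -> Prop :=
  ideal_generated (fun f =>
    exists2 B : {set 'I_m}, #|B| = l & f = \prod_(j in B) 'X_(rshift n j)).

Definition irrelevant_ideal (K : fieldType) (N : nat) : {mpoly K[N]} -> Prop :=
  ideal_generated (fun f => exists i : 'I_N, f = 'X_i).

(* Membership in the graded piece S_d of the polynomial ring, for d in Z;
   S_d = 0 when d < 0. *)
Definition in_degree (K : fieldType) (N : nat) (d : int) (p : {mpoly K[N]}) :
    Prop :=
  match d with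
  | Posz e => p \is e.-homog
  | Negz _ => p = 0
  end.

(* The data ... -> F_1 -> F_0 -> S, with F_k = \bigoplus_i S(-d_{k,i}) for
   d_{k,i} = gf_deg k i. Elements of F_k are row vectors of length gf_rank k and
   maps act by right multiplication, so row i of a matrix is the image of the
   i-th basis vector, which has degree d_{k,i}. *)
Record graded_free_data (K : fieldType) (N : nat) := GradedFreeData {
  gf_rank : nat -> nat;
  gf_deg : forall k, 'I_(gf_rank k) -> int;
  gf_diff : forall k, 'M[{mpoly K[N]}]_(gf_rank k.+1, gf_rank k);
  gf_aug : 'M[{mpoly K[N]}]_(gf_rank 0, 1)
}.

(* F is a finite graded free resolution of the ideal M of S; the augmentation
   F_0 -> M is given as a map to S with image M. *)
Record is_graded_free_resolution (K : fieldType) (N : nat)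
    (F : graded_free_data K N) (M : {mpoly K[N]} -> Prop) : Prop := {
  gfr_finite : exists g : nat, forall k, (g < k)%N -> gf_rank F k = 0%N;
  gfr_diff_graded : forall k (i : 'I_(gf_rank F k.+1)) (j : 'I_(gf_rank F k)),
    in_degree (gf_deg i - gf_deg j) (gf_diff F k i j);
  gfr_aug_graded : forall i : 'I_(gf_rank F 0),
    in_degree (gf_deg i) (gf_aug F i 0);
  gfr_exact : forall k (v : 'rV[{mpoly K[N]}]_(gf_rank F k.+1)),
    v *m gf_diff F k = 0 <-> exists w, v = w *m gf_diff F k.+1;
  gfr_exact0 : forall v : 'rV[{mpoly K[N]}]_(gf_rank F 0),
    v *m gf_aug F = 0 <-> exists w, v = w *m gf_diff F 0;
  gfr_image : forall f : {mpoly K[N]},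
    M f <-> exists v : 'rV_(gf_rank F 0), (v *m gf_aug F) 0 0 = f
}.

(* Minimality: the image of F_{k+1} lies in mm F_k, mm the irrelevant ideal. *)
Definition is_minimal (K : fieldType) (N : nat) (F : graded_free_data K N) :
    Prop :=
  forall k (i : 'I_(gf_rank F k.+1)) (j : 'I_(gf_rank F k)),
    irrelevant_ideal (gf_diff F k i j).

Definition is_minimal_graded_free_resolution (K : fieldType) (N : nat)
    (F : graded_free_data K N) (M : {mpoly K[N]} -> Prop) : Prop :=
  is_graded_free_resolution F M /\ is_minimal F.

Definition is_max_shift (K : fieldType) (N : nat) (F : graded_free_data K N)
    (c : int) : Prop :=
  (exists k (i : 'I_(gf_rank F k)), gf_deg i - k%:Z = c) /\
  (forall k (i : 'I_(gf_rank F k)), gf_deg i - k%:Z <= c).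

(* reg(M) = c for an ideal M of S. The minimal resolution is only unique up to
   isomorphism, so we ask that one exists and that each of them gives c. *)
Definition regularity_is (K : fieldType) (N : nat) (M : {mpoly K[N]} -> Prop)
    (c : int) : Prop :=
  (exists F, is_minimal_graded_free_resolution F M) /\
  (forall F, is_minimal_graded_free_resolution F M -> is_max_shift F c).

(* Main.v *)
(* The squarefree monomials x_A y_B with |A| = q and |B| = r are the bases of a
   matroid on the n + m variables (a direct sum of two uniform matroids). By the
   exchange property the ideal they generate has linear quotients: adding the
   generators one at a time in a suitable order, each successive colon ideal is
   generated by variables. Since an ideal generated by variables has linear
   quotients too, iterated mapping cones produce a resolution of I_q J_r whose
   k-th shifts are all q + r + k. Such a resolution is minimal, and comparing it
   with any other minimal resolution forces the same shifts there. *)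
Require Import Defs.
From HB Require Import structures.
From mathcomp Require Import all_boot all_order all_algebra.
From mathcomp Require Import mpoly zify.
From Stdlib Require Import IndefiniteDescription.

Set Implicit Arguments.
Unset Strict Implicit.
Unset Printing Implicit Defensive.

Import Order.TTheory GRing.Theory Num.Theory.
Local Open Scope ring_scope.

(** * Choice and exactness for matrices over a commutative ring *)

Lemma dependent_choice_seq (T : nat -> Type) (Q : forall k, T k -> Prop)
    (R : forall k, T k -> T k.+1 -> Prop) (x0 : T 0) :
  Q 0 x0 ->
  (forall k x, Q k x -> exists2 y, Q k.+1 y & R k x y) ->
  exists f : forall k, T k,
    [/\ f 0 = x0, forall k, Q k (f k) & forall k, R k (f k) (f k.+1)].
Proof.
move=> Q0 step.
(* Bundling the invariant [Q] into a sigma type turns the step into a total function, which plain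
   recursion iterates. *)
have next k (x : {x : T k | Q k x}) :
    {y : {y : T k.+1 | Q k.+1 y} | R k (sval x) (sval y)}.
  apply: constructive_indefinite_description; case: x => x Qx.
  by have [y Qy Rxy] := step k x Qx; exists (exist _ y Qy).
pose f := fix f k : {x : T k | Q k x} :=
  if k is k'.+1 then sval (next k' (f k')) else exist _ x0 Q0.
exists (fun k => sval (f k)); split=> // k; first exact: svalP.
exact: svalP (next k (f k)).
Qed.

Lemma eq_rows_mulmx (R : comNzRingType) (s p q : nat)
    (A : 'M[R]_(s, q)) (D : 'M[R]_(p, q)) :
  (forall i, exists w, row i A = w *m D) -> exists X, A = X *m D.
Proof.
move=> /functional_choice [w Hw]; exists (\matrix_i w i).
by apply/row_matrixP => i; rewrite row_mul rowK.
Qed.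

Definition exact_at (R : comNzRingType) (a b c : nat)
    (D1 : 'M[R]_(a, b)) (D0 : 'M[R]_(b, c)) :=
  forall v : 'rV[R]_b, v *m D0 = 0 <-> exists w, v = w *m D1.

(** Projectivity of a free module in matrix form: exactness is applied to each row, and choice
    collects the preimages. *)
Lemma exact_mx (R : comNzRingType) (a b c s : nat)
    (D1 : 'M[R]_(a, b)) (D0 : 'M[R]_(b, c)) (A : 'M[R]_(s, b)) :
  exact_at D1 D0 -> A *m D0 = 0 -> exists X, A = X *m D1.
Proof.
move=> ex A0; apply: eq_rows_mulmx => i; apply/ex.
by rewrite -row_mul A0 row0.
Qed.

Lemma exact_mulmx0 (R : comNzRingType) (a b c : nat)
    (D1 : 'M[R]_(a, b)) (D0 : 'M[R]_(b, c)) :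
  exact_at D1 D0 -> D1 *m D0 = 0.
Proof.
move=> ex; apply/row_matrixP => i; rewrite row_mul row0.
by apply/ex; exists (delta_mx 0 i); rewrite -rowE.
Qed.

(** * Homogeneous polynomials and degree-preserving matrices *)

Section Degrees.
Variables (K : fieldType) (N : nat).
Implicit Types (p q u f : {mpoly K[N]}) (d e : int).

(** No monomial has negative degree, so one condition on supports covers both signs of [d]. *)
Lemma in_degreeP d p :
  in_degree d p <-> forall m, m \in msupp p -> (mdeg m)%:Z = d.
Proof.
case: d => e /=.
  split=> [/dhomogP h m /h /= -> //|h]; apply/dhomogP => m /h /= [].
  by move=> ->.
split=> [-> m|h]; first by rewrite msupp0.
by apply: msuppnil0; case: (msupp p) h => // m s /(_ m (mem_head _ _)).
Qed.

Lemma in_degree0 d : in_degree d (0 : {mpoly K[N]}).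
Proof. by apply/in_degreeP => m; rewrite msupp0. Qed.

Lemma in_degree1 : in_degree 0 (1 : {mpoly K[N]}).
Proof. exact: dhomog1. Qed.

Lemma in_degreeN d p : in_degree d p -> in_degree d (- p).
Proof.
by move=> /in_degreeP h; apply/in_degreeP => m; rewrite (perm_mem (msuppN p)) => /h.
Qed.

Lemma in_degreeM d e p q :
  in_degree d p -> in_degree e q -> in_degree (d + e) (p * q).
Proof.
move=> /in_degreeP hp /in_degreeP hq; apply/in_degreeP => m /msuppM_le.
by case/allpairsP => -[m1 m2] /= [/hp <- /hq <- ->]; rewrite mdegD PoszD.
Qed.

Lemma in_degree_sum (I : Type) (r : seq I) (P : pred I) (F : I -> {mpoly K[N]}) d :
  (forall i, in_degree d (F i)) -> in_degree d (\sum_(i <- r | P i) F i).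
Proof.
move=> h; elim/big_rec: _ => [|i x _ /in_degreeP hx]; first exact: in_degree0.
apply/in_degreeP => m /msuppD_le; rewrite mem_cat => /orP[|/hx //].
by move: m; apply/in_degreeP.
Qed.

Lemma msupp_sum_pred (s : seq 'X_{1..N}) (P : pred 'X_{1..N}) (c : 'X_{1..N} -> K) m :
  m \in msupp (\sum_(k <- s | P k) c k *: 'X_[k]) -> P m.
Proof.
elim/big_rec: _ => [|k x Pk IH]; first by rewrite msupp0.
move=> /msuppD_le; rewrite mem_cat => /orP[/msuppZ_le|//].
by rewrite msuppX inE => /eqP ->.
Qed.

Lemma msupp_split (P : pred 'X_{1..N}) p :
  exists p1 p2, [/\ p = p1 + p2, forall m, m \in msupp p1 -> P m
    & forall m, m \in msupp p2 -> m \in msupp p /\ ~~ P m].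
Proof.
exists (\sum_(m <- msupp p | P m) p@_m *: 'X_[m]).
exists (\sum_(m <- msupp p | ~~ P m) p@_m *: 'X_[m]); split.
- by rewrite {1}[p]mpolyE (bigID P).
- by move=> m /msupp_sum_pred.
move=> m hm; split; last exact: msupp_sum_pred hm.
move: hm; rewrite big_seq_cond => /(@msupp_sum_pred _ (fun k => _ && _)).
by case/andP.
Qed.

(** Matrices of degree-preserving maps between graded free modules whose basis vectors have degrees
    [dr] and [dc]. *)
Definition graded_mx (a b : nat) (dr : 'I_a -> int) (dc : 'I_b -> int)
  (A : 'M[{mpoly K[N]}]_(a, b)) :=
  forall i j, in_degree (dr i - dc j) (A i j).

Lemma graded_mulmx (a b c : nat) (da : 'I_a -> int) (db : 'I_b -> int)
    (dc : 'I_c -> int) (A : 'M[{mpoly K[N]}]_(a, b)) (B : 'M[{mpoly K[N]}]_(b, c)) :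
  graded_mx da db A -> graded_mx db dc B -> graded_mx da dc (A *m B).
Proof.
move=> hA hB i k; rewrite mxE; apply: in_degree_sum => j.
by rewrite -(subrKA (db j)); apply: in_degreeM.
Qed.

(** Each entry of [w] is replaced by its component of degree [d - da i]. The discarded monomials
    cannot contribute to the homogeneous vector [w *m D], so the image is unchanged. *)
Lemma graded_lift (a b : nat) (da : 'I_a -> int) (db : 'I_b -> int) d
    (D : 'M[{mpoly K[N]}]_(a, b)) (w : 'rV_a) :
  graded_mx da db D -> graded_mx (fun=> d) db (w *m D) ->
  exists2 w' : 'rV_a, graded_mx (fun=> d) da w' & w' *m D = w *m D.
Proof.
move=> hD hw.
have /functional_choice [w' hw'] : forall i, exists x, in_degree (d - da i) x /\
    forall m, m \in msupp (w 0 i - x) -> (mdeg m)%:Z != d - da i.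
  move=> i; have [x [y [-> hx hy]]] :=
    msupp_split (fun m => (mdeg m)%:Z == d - da i) (w 0 i).
  exists x; split; first by apply/in_degreeP => m /hx /eqP.
  by rewrite addrC addKr => m /hy [].
have gw' : graded_mx (fun=> d) da (\row_i w' i).
  by move=> i j; rewrite mxE; case: (hw' j).
exists (\row_i w' i) => //.
apply/eqP; rewrite eq_sym -subr_eq0; apply/eqP/matrixP => i j; rewrite ord1 => {i}.
rewrite [RHS]mxE; apply: msuppnil0.
have hs : in_degree (d - db j) ((w *m D - (\row_i w' i) *m D) 0 j).
  have /in_degreeP h1 := hw 0 j.
  have /in_degreeP h2 := graded_mulmx gw' hD 0 j.
  apply/in_degreeP => m; rewrite !mxE in h1 h2 *.
  by move/msuppB_le; rewrite mem_cat => /orP[/h1|/h2].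
move/in_degreeP: hs => hs.
(* A monomial of the difference is a product of a discarded monomial and one of [D k j]; counting
   degrees, the discarded one would lie in degree [d - da k], which was kept. *)
case E: (msupp _) => [//|m s]; move: (hs m); rewrite E mem_head => /(_ isT) hm.
have: m \in msupp ((w *m D - (\row_i w' i) *m D) 0 j) by rewrite E mem_head.
rewrite -mulmxBl mxE => /msupp_sum_le /flattenP [_ /mapP [k _ ->]] /=.
move=> /msuppM_le /allpairsP [[m1 m2] /= [h1 h2 mE]].
move: h1; rewrite !mxE => /(proj2 (hw' k)) /negP [].
have /in_degreeP /(_ _ h2) e2 := hD k j.
rewrite -(addrK (mdeg m2)%:Z (mdeg m1)%:Z) -PoszD -mdegD -mE hm e2.
by rewrite opprB addrA subrK.
Qed.

Lemma graded_lift_mx (s a b : nat) (ds : 'I_s -> int) (da : 'I_a -> int)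
    (db : 'I_b -> int) (A : 'M[{mpoly K[N]}]_(s, b)) (D : 'M[{mpoly K[N]}]_(a, b)) :
  graded_mx da db D -> graded_mx ds db A -> (exists X, A = X *m D) ->
  exists2 X, graded_mx ds da X & A = X *m D.
Proof.
move=> hD hA [X AE].
have /functional_choice [w hw] : forall i, exists w : 'rV_a,
    graded_mx (fun=> ds i) da w /\ w *m D = row i A.
  move=> i; have [|w gw hw] := @graded_lift _ _ _ _ (ds i) D (row i X) hD.
    by move=> k j; rewrite -row_mul -AE mxE.
  by exists w; split=> //; rewrite hw -row_mul -AE.
exists (\matrix_i w i); last first.
  by apply/row_matrixP => i; rewrite row_mul rowK; case: (hw i).
by move=> i j; rewrite mxE; apply: (proj1 (hw i)).
Qed.

End Degrees.

(** * Maps of resolutions and mapping cones *)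

Section Resolutions.
Variables (K : fieldType) (N : nat).
Implicit Types (F G L : graded_free_data K N) (M I J : {mpoly K[N]} -> Prop).

(** Multiplication by [u] lifts step by step because free modules are projective. With [u = 1] this
    compares two resolutions of one ideal; with [u] a new generator it supplies the map for a
    mapping cone. *)
Lemma comparison F G M M' (e : int) (u : {mpoly K[N]}) :
  is_graded_free_resolution F M -> is_graded_free_resolution G M' ->
  in_degree e u -> (forall f, M f -> M' (f * u)) ->
  exists a : forall k, 'M_(gf_rank F k, gf_rank G k),
    [/\ a 0 *m gf_aug G = u *: gf_aug F,
        forall k, a k.+1 *m gf_diff G k = gf_diff F k *m a k
      & forall k, graded_mx (fun i => gf_deg i + e) (@gf_deg _ _ G k) (a k)].
Proof.
move=> rF rG hu hM.
have gaug : graded_mx (@gf_deg _ _ G 0) (fun=> 0) (gf_aug G).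
  by move=> i j; rewrite subr0 ord1; apply: gfr_aug_graded rG _.
have shiftF k : graded_mx (fun i => gf_deg i + e) (fun j => gf_deg j + e)
    (gf_diff F k).
  by move=> i j; rewrite opprD addrACA subrr addr0; apply: gfr_diff_graded rF _ _ _.
have [a0 ga0 a0E] : exists2 X, graded_mx (fun i => gf_deg i + e) (@gf_deg _ _ G 0) X
    & u *: gf_aug F = X *m gf_aug G.
  apply: graded_lift_mx gaug _ _ => [i j|].
    rewrite subr0 mxE ord1 addrC; apply: in_degreeM => //.
    exact: gfr_aug_graded rF _.
  apply: eq_rows_mulmx => i.
  have /hM /(gfr_image rG) [w hw] : M (gf_aug F i 0).
    by apply/(gfr_image rF); exists (delta_mx 0 i); rewrite -rowE mxE.
  by exists w; apply/matrixP => j k; rewrite !ord1 hw !mxE mulrC.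
(* The existence of [X] is carried along because it is exactly what the next lift requires. *)
pose Q k (a : 'M_(gf_rank F k, gf_rank G k)) :=
  graded_mx (fun i => gf_deg i + e) (@gf_deg _ _ G k) a /\
  exists X, gf_diff F k *m a = X *m gf_diff G k.
have [||a [a0E' Qa Ra]] := @dependent_choice_seq _ Q
    (fun k a b => b *m gf_diff G k = gf_diff F k *m a) a0.
- split=> //; apply: exact_mx (gfr_exact0 rG) _.
  by rewrite -mulmxA -a0E -scalemxAr (exact_mulmx0 (gfr_exact0 rF)) scaler0.
- move=> k a [ga ha].
  have [b gb bE] := graded_lift_mx (gfr_diff_graded rG (k := k))
    (graded_mulmx (shiftF k) ga) ha.
  exists b => //; split=> //; apply: exact_mx (gfr_exact rG (k := k)) _.
  by rewrite -mulmxA -bE mulmxA (exact_mulmx0 (gfr_exact rF (k := k))) mul0mx.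
by exists a; split=> // [|k]; [rewrite a0E' | case: (Qa k)].
Qed.

(* The homotopy [h] from [t] to [0] is built degree by degree; minimality makes
   both [h D] and [D h] vanish modulo the irrelevant ideal. *)
Lemma nullhomotopic_minimal F M (t : forall k, 'M_(gf_rank F k)) :
  is_minimal_graded_free_resolution F M ->
  t 0%N *m gf_aug F = 0 ->
  (forall k, t k.+1 *m gf_diff F k = gf_diff F k *m t k) ->
  forall k i j, (t k i j)@_0 = 0.
Proof.
move=> [rF mF] t0 tS.
have D0 k i j : (gf_diff F k i j)@_0 = 0.
  have [s [a [g [hg ->]]]] := mF k i j.
  rewrite raddf_sum big1 // => l _; have [v ->] := hg l.
  by rewrite /= rmorphM /= mcoeffX mnm1_eq0 mulr0.
have mulD k s (A : 'M_(s, _)) i j : ((A *m gf_diff F k) i j)@_0 = 0.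
  rewrite mxE raddf_sum big1 // => l _.
  by rewrite /= rmorphM /= D0 mulr0.
have Dmul k s (A : 'M_(_, s)) i j : ((gf_diff F k *m A) i j)@_0 = 0.
  rewrite mxE raddf_sum big1 // => l _.
  by rewrite /= rmorphM /= D0 mul0r.
(* The equation carried for [h] makes [t k.+1 - gf_diff F k *m h] a cycle, which exactness lifts to
   the next [h']. *)
have hom k : (exists h, gf_diff F k *m (t k - h *m gf_diff F k) = 0) /\
    (forall i j, (t k i j)@_0 = 0).
  elim: k => [|k [[h hE] _]].
    have [h hE] := exact_mx (gfr_exact0 rF) t0.
    split; last by move=> i j; rewrite hE mulD.
    by exists h; rewrite hE subrr mulmx0.
  have [|h' h'E] := @exact_mx _ _ _ _ _ _ _
      (t k.+1 - gf_diff F k *m h) (gfr_exact rF (k := k)).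
    by rewrite mulmxBl tS -mulmxA -mulmxBr.
  have tE := esym (subrK (gf_diff F k *m h) (t k.+1)).
  rewrite h'E in tE.
  split; last by move=> i j; rewrite tE mxE mcoeffD mulD Dmul addr0.
  exists h'; rewrite tE [h' *m _ + _]addrC addrK mulmxA.
  by rewrite (exact_mulmx0 (gfr_exact rF (k := k))) mul0mx.
by move=> k; case: (hom k).
Qed.

Definition linear_resolution (c : int) F M :=
  is_graded_free_resolution F M /\ forall k (i : 'I_(gf_rank F k)), gf_deg i = c + k%:Z.

(** For comparison maps [a : F -> G] and [b : G -> F], the map [a b - 1] covers zero on [M], so
    minimality of [F] makes its constant terms vanish. Hence each row of [a k] has an entry with
    nonzero constant term, and such an entry joins basis vectors of equal degree. *)
Lemma minimal_shifts_linear c F G M :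
  linear_resolution c G M -> is_minimal_graded_free_resolution F M ->
  forall k (i : 'I_(gf_rank F k)), gf_deg i = c + k%:Z.
Proof.
move=> [rG gG] mF k i; have rF := proj1 mF.
have M1 f : M f -> M (f * 1) by rewrite mulr1.
have [a [a0 aS ga]] := comparison rF rG (in_degree1 K N) M1.
have [b [b0 bS _]] := comparison rG rF (in_degree1 K N) M1.
have := @nullhomotopic_minimal F M (fun k => a k *m b k - 1%:M) mF _ _ k i i.
have -> : (a 0 *m b 0 - 1%:M) *m gf_aug F = 0.
  by rewrite mulmxBl mul1mx -mulmxA b0 scale1r a0 scale1r subrr.
have tS l : (a l.+1 *m b l.+1 - 1%:M) *m gf_diff F l
          = gf_diff F l *m (a l *m b l - 1%:M).
  by rewrite mulmxBl mulmxBr mul1mx mulmx1 -mulmxA bS !mulmxA aS.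
move=> /(_ erefl tS).
rewrite mxE [in X in _ + X]mxE [(1%:M) i i]mxE eqxx mcoeffB mcoeff1 eqxx => /eqP.
rewrite subr_eq0 mxE raddf_sum /=; case: (pickP (fun j => (a k i j)@_0 != 0)) => [j aj _|a0'].
  have /in_degreeP /(_ 0%MM) := ga k i j.
  rewrite mcoeff_msupp aj mdeg0 gG addr0 => /(_ isT) /esym /eqP.
  by rewrite subr_eq0 => /eqP.
rewrite big1 => [|j _]; first by rewrite eq_sym oner_eq0.
by rewrite rmorphM /= (eqP (negbFE (a0' j))) mul0r.
Qed.

Definition has_linear_resolution c M := exists F, linear_resolution c F M.

Lemma eq_has_linear_resolution c M M' :
  (forall f, M f <-> M' f) -> has_linear_resolution c M -> has_linear_resolution c M'.
Proof.
move=> MM' [F [[f1 f2 f3 f4 f5 f6] gF]]; exists F; split=> //; split=> // f.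
by rewrite -MM'.
Qed.

(** The zero ideal starts the inductions that add generators one at a time; its zero complex is
    linear for every [c]. *)
Lemma linear_resolution0 c : has_linear_resolution c (fun f => f = 0).
Proof.
exists {| gf_rank := fun=> 0%N; gf_deg := fun k _ => c + k%:Z;
  gf_diff := fun=> 0; gf_aug := 0 |}; split=> //; split=> //=.
- by exists 0%N.
- by move=> k [].
- by case.
- by move=> k v; split=> _; [exists 0; rewrite thinmx0 mulmx0|rewrite mulmx0].
- by move=> v; split=> _; [exists 0; rewrite thinmx0 mulmx0|rewrite mulmx0].
move=> f; split=> [->|[v <-]]; last by rewrite mulmx0 mxE.
by exists 0; rewrite mulmx0 mxE.
Qed.

Lemma in_degree_block (a b c d : nat) e (A : 'M[{mpoly K[N]}]_(a, b))
    (B : 'M_(a, c)) (C : 'M_(d, b)) (D : 'M_(d, c)) :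
  (forall i j, in_degree e (A i j)) -> (forall i j, in_degree e (B i j)) ->
  (forall i j, in_degree e (C i j)) -> (forall i j, in_degree e (D i j)) ->
  forall i j, in_degree e (block_mx A B C D i j).
Proof.
by move=> hA hB hC hD i j; rewrite /block_mx !mxE; case: split => k; rewrite !mxE;
  case: split => l.
Qed.

(** A diagram chase: if [v = (x, y)] is in the kernel, [y = l L1] for some [l], and [x + l u1] is a
    cycle for [G0], hence some [g G1]. The preimage is [(g, - l)], the sign matching [- L1]. *)
Lemma cone_exact (R : comNzRingType) (a2 a1 a0 b1 b0 z : nat)
    (G1 : 'M[R]_(a2, a1)) (G0 : 'M_(a1, a0)) (L1 : 'M_(b1, b0)) (L0 : 'M_(b0, z))
    (u1 : 'M_(b1, a1)) (u0 : 'M_(b0, a0)) :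
  exact_at G1 G0 -> exact_at L1 L0 -> u1 *m G0 = L1 *m u0 ->
  exact_at (block_mx G1 0 u1 (- L1)) (block_mx G0 0 u0 (- L0)).
Proof.
move=> exG exL comm v; split; last first.
  case=> w ->; rewrite -mulmxA mulmx_block !mulmx0 !mul0mx !mulNmx !mulmxN opprK.
  by rewrite (exact_mulmx0 exG) (exact_mulmx0 exL) comm subrr !addr0 block_mx_const mulmx0.
rewrite -[v]hsubmxK mul_row_block mulmx0 add0r -[0]row_mx0 mulmxN.
case/eq_row_mx => gE /eqP; rewrite oppr_eq0 => /eqP /exL [l lE].
have /exG [g hg] : (lsubmx v + l *m u1) *m G0 = 0.
  by rewrite mulmxDl -mulmxA comm mulmxA -lE.
exists (row_mx g (- l)); rewrite mul_row_block mulmx0 add0r !mulNmx mulmxN opprK -lE.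
by rewrite -hg addrK.
Qed.

(** At the bottom the second complex ends in the ring, mapped to itself by [u]. The colon
    hypothesis, that [s u] lies in the image of [G0] only for [s] in that of [L0], replaces
    exactness there. *)
Lemma cone_exact0 (R : comNzRingType) (a1 a0 b0 : nat)
    (G1 : 'M[R]_(a1, a0)) (G0 : 'M_(a0, 1)) (L0 : 'M_(b0, 1))
    (u0 : 'M_(b0, a0)) (u : R) :
  exact_at G1 G0 -> u0 *m G0 = u *: L0 ->
  (forall s : 'M_1, (exists g : 'rV_a0, s *m u%:M = g *m G0) ->
    exists l : 'rV_b0, s = l *m L0) ->
  exact_at (block_mx G1 0 u0 (- L0)) (col_mx G0 u%:M).
Proof.
move=> exG comm colon v; split; last first.
  case=> w ->; rewrite -mulmxA mul_block_col mul0mx addr0 (exact_mulmx0 exG) comm.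
  by rewrite mul_mx_scalar scalerN subrr col_mx0 mulmx0.
rewrite -[v]hsubmxK mul_row_col => /eqP; rewrite addrC addr_eq0 => /eqP vE.
have [|l lE] := colon (rsubmx v).
  by exists (- lsubmx v); rewrite vE mulNmx.
have /exG [g hg] : (lsubmx v + l *m u0) *m G0 = 0.
  rewrite mulmxDl -mulmxA comm -scalemxAr -lE -mul_mx_scalar vE.
  by rewrite addrN.
exists (row_mx g (- l)); rewrite mul_row_block mulmx0 add0r !mulNmx mulmxN opprK -lE.
by rewrite -hg addrK.
Qed.

(** The cone uses the augmented complex of [L], shifted by one: the extra [1] in degree 0 is the
    ring, whose basis vector goes to the new generator. *)
Definition cone_rank F L k :=
  if k is k'.+1 then (gf_rank F k + gf_rank L k')%N else (gf_rank F 0 + 1)%N.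

Definition cone_diff F L (a : forall k, 'M_(gf_rank L k, gf_rank F k)) k :
    'M_(cone_rank F L k.+1, cone_rank F L k) :=
  if k is k'.+1 then block_mx (gf_diff F k'.+1) 0 (a k'.+1) (- gf_diff L k')
  else block_mx (gf_diff F 0) 0 (a 0) (- gf_aug L).

(* The mapping cone of multiplication by [u] from a resolution of [I : u],
   shifted by [c], to one of [I]. *)
Lemma linear_resolution_cone (c : int) (u : {mpoly K[N]}) I J :
  has_linear_resolution c I -> has_linear_resolution 1 J -> in_degree c u ->
  (forall f, J f <-> I (f * u)) ->
  has_linear_resolution c (fun f => exists g s, I g /\ f = g + s * u).
Proof.
move=> [F [rF gF]] [L [rL gL]] hu IJ.
have [a [a0 aS ga]] := comparison rL rF hu (fun f => proj1 (IJ f)).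
exists {| gf_rank := cone_rank F L; gf_deg := fun k _ => c + k%:Z;
  gf_diff := cone_diff a; gf_aug := col_mx (gf_aug F) u%:M |}; split=> //; split=> /=.
- have [[x hx] [y hy]] := (gfr_finite rF, gfr_finite rL).
  exists (maxn x y.+1) => -[|k] //; rewrite gtn_max ltnS /= => /andP[xk yk].
  by rewrite hx // hy.
- have a1 k i j : in_degree 1 (a k i j).
    have := ga k i j; rewrite gF gL; congr in_degree.
    by lia.
  have F1 k i j : in_degree 1 (gf_diff F k i j).
    have := gfr_diff_graded rF i j; rewrite !gF; congr in_degree.
    by lia.
  have L1 k i j : in_degree 1 (gf_diff L k i j).
    have := gfr_diff_graded rL i j; rewrite !gL; congr in_degree.
    by lia.
  have L10 i j : in_degree 1 (gf_aug L i j).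
    by have := gfr_aug_graded rL i; rewrite gL addr0 ord1.
  move=> k i j; have -> : c + k.+1 - (c + k) = 1 :> int.
    by lia.
  case: k i j => [|k]; apply: in_degree_block => // i j;
    by rewrite mxE; do ?[exact: in_degree0|apply: in_degreeN].
- move=> i; rewrite addr0 mxE; case: split => j.
    by have := gfr_aug_graded rF j; rewrite gF addr0.
  by rewrite !ord1 mxE.
- case=> [|k].
    by apply: cone_exact; [exact: (gfr_exact rF (k := 0))|exact: gfr_exact0 rL|exact: aS].
  by apply: cone_exact; [exact: (gfr_exact rF (k := k.+1))|exact: (gfr_exact rL (k := k))|exact: aS].
- apply: cone_exact0 => // [|s [g gE]]; first exact: gfr_exact0 rF.
  have /IJ /(gfr_image rL) [l lE] : I (s 0 0 * u).
    apply/(gfr_image rF); exists g.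
    by rewrite -gE mul_mx_scalar mxE mulrC.
  by exists l; apply/matrixP => i j; rewrite !ord1.
move=> f; split=> [[g [s [/(gfr_image rF) [v <-] ->]]]|[v <-]].
  exists (row_mx v s%:M).
  by rewrite mul_row_col -scalar_mxM !mxE eqxx.
exists ((lsubmx v *m gf_aug F) 0 0), (rsubmx v 0 0); split.
  by apply/(gfr_image rF); exists (lsubmx v).
by rewrite -[v in LHS]hsubmxK mul_row_col mul_mx_scalar !mxE mulrC.
Qed.

End Resolutions.

(** * Monomial ideals and their colons *)

Section MonomialIdeals.
Variables (K : fieldType) (N : nat).
Implicit Types (P : pred 'X_{1..N}) (u k : 'X_{1..N}) (f g : {mpoly K[N]}).
Implicit Types (T U V : {set 'I_N}) (B : pred {set 'I_N}).

(** When [P] is closed under adding exponents this is the ideal spanned by the monomials in [P], so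
    that sums and colons become conditions on exponents. *)
Definition monomial_ideal P f := forall k, k \in msupp f -> P k.

Lemma eq_monomial_ideal P P' : P =1 P' ->
  forall f, monomial_ideal P f <-> monomial_ideal P' f.
Proof. by move=> PP' f; split=> h k /h; rewrite PP'. Qed.

Lemma monomial_idealD P f g :
  monomial_ideal P f -> monomial_ideal P g -> monomial_ideal P (f + g).
Proof. by move=> hf hg k /msuppD_le; rewrite mem_cat => /orP[/hf|/hg]. Qed.

Lemma monomial_ideal_sum P (I : Type) (r : seq I) (F : I -> {mpoly K[N]}) :
  (forall i, monomial_ideal P (F i)) -> monomial_ideal P (\sum_(i <- r) F i).
Proof.
move=> h; elim/big_rec: _ => [k|i x _ hx]; first by rewrite msupp0.
exact: monomial_idealD.
Qed.

Lemma monomial_idealM (P P' Q : pred 'X_{1..N}) f g :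
  (forall k k', P k -> P' k' -> Q (k + k')%MM) ->
  monomial_ideal P f -> monomial_ideal P' g -> monomial_ideal Q (f * g).
Proof.
by move=> h hf hg k /msuppM_le /allpairsP [[k1 k2] /= [/hf h1 /hg h2 ->]]; apply: h.
Qed.

Lemma monomial_ideal_colon P u f :
  monomial_ideal (fun k => P (k + u)%MM) f <-> monomial_ideal P (f * 'X_[u]).
Proof.
split=> h k; last by move=> kf; apply: h; rewrite (perm_mem (msuppMX _ _)) addmC map_f.
by rewrite (perm_mem (msuppMX _ _)) => /mapP [k' /h hk ->]; rewrite addmC.
Qed.

Lemma monomial_ideal_add P u f : (forall k k', P k -> P (k + k')%MM) ->
  (exists g s, monomial_ideal P g /\ f = g + s * 'X_[u]) <->
  monomial_ideal (fun k => P k || (u <= k)%MM) f.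
Proof.
move=> upP; split=> [[g [s [hg ->]]]|hf].
  apply: monomial_idealD => [k /hg -> //|k].
  rewrite (perm_mem (msuppMX _ _)) => /mapP [k' _ ->].
  by rewrite lem_addr orbT.
have [f1 [f2 [fE h1 h2]]] := msupp_split P f.
(* The monomials of [f] outside [P] are all divisible by ['X_[u]]; the second witness is their
   termwise quotient. *)
exists f1, (\sum_(k <- msupp f2) f2@_k *: 'X_[k - u]); split=> //; rewrite [LHS]fE; congr (_ + _).
rewrite mulr_suml [LHS]mpolyE; apply: eq_big_seq => k /h2 [/hf hk nPk].
by rewrite -scalerAl -mpolyXD submK //; move: hk; rewrite (negbTE nPk).
Qed.

Lemma has_linear_resolution_add_monomial (c : nat) P u :
  (forall k k', P k -> P (k + k')%MM) -> mdeg u = c ->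
  has_linear_resolution c (monomial_ideal P) ->
  has_linear_resolution 1 (monomial_ideal (fun k => P (k + u)%MM)) ->
  has_linear_resolution c (monomial_ideal (fun k => P k || (u <= k)%MM)).
Proof.
move=> upP uc hP hPu.
apply: eq_has_linear_resolution (fun f => monomial_ideal_add u f upP) _.
apply: linear_resolution_cone hP hPu _ (monomial_ideal_colon P u).
by rewrite /= dhomogX; apply/eqP.
Qed.

Lemma linear_resolution_pred0 c P :
  P =1 pred0 -> has_linear_resolution c (monomial_ideal P).
Proof.
move=> P0; apply: eq_has_linear_resolution (linear_resolution0 K N c) => f.
rewrite /monomial_ideal; split=> [-> k|h]; first by rewrite msupp0.
by apply: msuppnil0; case: (msupp f) h => // k s /(_ k (mem_head _ _)); rewrite P0.
Qed.

(** Induction on [#|V|]: multiplying by a variable [x] does not affect divisibility by the others,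
    so the colon by [x] of the ideal of the other variables is that ideal itself, already
    resolved. *)
Lemma has_linear_resolution_variables V :
  has_linear_resolution 1 (monomial_ideal (fun k => [exists v in V, (0 < k v)%N])).
Proof.
move En: #|V| => c; elim: c V En => [V /cards0_eq ->|c IH V Vc].
  by apply: linear_resolution_pred0 => k; apply/exists_inP => -[v]; rewrite inE.
have /card_gt0P [x xV] : (0 < #|V|)%N by rewrite Vc.
have {IH} IH : has_linear_resolution 1
    (monomial_ideal (fun k => [exists v in V :\ x, (0 < k v)%N])).
  by apply: IH; apply/eqP; rewrite -eqSS -Vc (cardsD1 x V) xV.
have up k k' : [exists v in V :\ x, (0 < k v)%N] -> [exists v in V :\ x, (0 < (k + k')%MM v)%N].
  case/exists_inP => v vV kv; apply/exists_inP; exists v => //.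
  by rewrite mnmDE addn_gt0 kv.
have hadd := @has_linear_resolution_add_monomial 1 _ U_(x)%MM up (mdeg1 x) IH.
apply: eq_has_linear_resolution (hadd _).
  apply: eq_monomial_ideal => k; apply/orP/exists_inP => [[/exists_inP [v]|/mnm_lepP/(_ x)]|].
  - by rewrite !inE => /andP[_ vV] kv; exists v.
  - by rewrite mnm1E eqxx; exists x.
  case=> v vV kv; case: (eqVneq v x) => [vx|vx].
    right; apply/mnm_lepP => i; rewrite mnm1E; case: eqP => // <-.
    by rewrite -vx.
  by left; apply/exists_inP; exists v; rewrite // !inE vx.
apply: eq_has_linear_resolution IH; apply: eq_monomial_ideal => k.
apply: eq_existsb => v; rewrite !inE mnmDE mnm1E eq_sym.
by case: eqVneq => //=; rewrite addn0.
Qed.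

(** * Comparing sets by binary codes, and linear quotients from basis exchange *)

Definition code T := (\sum_(i in T) 2 ^ i)%N.

(** After the common part is cancelled, [U] keeps [2 ^ p], while [T] keeps at most the sum of all
    smaller powers of two. *)
Lemma code_lt T U (p : 'I_N) : p \in U -> p \notin T ->
  (forall v, v \in T -> v \notin U -> (v < p)%N) -> (code T < code U)%N.
Proof.
move=> pU pT hv; rewrite /code (big_setID U) [X in (_ < X)%N](big_setID T) /=.
rewrite setIC ltn_add2l.
rewrite [X in (_ < X)%N](big_setD1 p) /=; last by rewrite inE pT.
apply: ltn_addr; apply: (@leq_ltn_trans (\sum_(i < N | i < p) 2 ^ i)%N).
  rewrite [X in (_ <= X)%N](bigID (mem (T :\: U))) /=.
  rewrite -[X in (X <= _)%N]addn0 leq_add // eq_leq //; apply: eq_bigl => v.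
  by rewrite inE; case: (boolP (v \in T)) => vT; case: (boolP (v \in U)) => vU;
    rewrite ?andbF // hv.
rewrite (big_ord_narrow (ltnW (ltn_ord p))) /=.
by elim: (p : nat) => [|j IH]; rewrite ?big_ord0 // big_ord_recr /= expnS mul2n
  -addnn ltn_add2r.
Qed.

(** Take [p] largest in the symmetric difference; were it in [T], [code_lt] would reverse the
    inequality of codes. *)
Lemma code_leq_exists T U : T != U -> (code T <= code U)%N ->
  exists p, [/\ p \in U, p \notin T & forall v, v \in T -> v \notin U -> (v < p)%N].
Proof.
move=> TU leTU.
have [i0 hi0] : exists i, (i \in T) != (i \in U).
  apply/existsP; apply: contra_neqT TU; rewrite negb_exists => /forallP h.
  by apply/setP => i; apply/eqP; move: (h i); rewrite negbK.
case: (@arg_maxnP _ i0 (fun i => (i \in T) != (i \in U)) (@nat_of_ord N) hi0) => p hp pmax.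
case: (boolP (p \in T)) hp => pT; case: (boolP (p \in U)) => pU // _.
  move: leTU; rewrite leqNgt (@code_lt U T p) // => v vU vT.
  have vp : (v <= p)%N by apply: pmax; rewrite vU (negbTE vT).
  by rewrite ltn_neqAle vp andbT; apply: contraNneq pU => /val_inj <-.
exists p; split=> // v vT vU.
have vp : (v <= p)%N by apply: pmax; rewrite vT (negbTE vU).
by rewrite ltn_neqAle vp andbT; apply: contraNneq pT => /val_inj <-.
Qed.

Definition indicator T : 'X_{1..N} := [multinom (i \in T : nat) | i < N].

Lemma mdeg_indicator T : mdeg (indicator T) = #|T|.
Proof.
by rewrite mdegE -sum1_card [RHS]big_mkcond /=; apply: eq_bigr => i _; rewrite mnmE; case: in_mem.
Qed.

Lemma indicator_leP T k : (indicator T <= k)%MM = [forall i in T, (0 < k i)%N].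
Proof.
apply/mnm_lepP/forall_inP => h i; first by move=> iT; have := h i; rewrite mnmE iT.
by rewrite mnmE; case: (boolP (i \in T)) => // /h.
Qed.

Definition basis_exchange B := forall T U p, B T -> B U -> p \in U -> p \notin T ->
  exists v, [/\ v \in T, v \notin U & B (v |: U :\ p)].

(* Adding the generators by increasing [code] gives linear quotients: if [p] is
   the largest element of the symmetric difference of two bases [T] and [U], and
   [p \in U], then exchanging [p] for some [v \in T] decreases the code of [U]. *)
Lemma has_linear_resolution_bases B (c : nat) :
  (forall T, B T -> #|T| = c) -> basis_exchange B ->
  has_linear_resolution c
    (monomial_ideal (fun k => [exists T, B T && (indicator T <= k)%MM])).
Proof.
move=> Bc exB.
(* The ideal of the bases of code below [t]. Distinct bases have distinct codes, so raising [t] by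
   one adds at most one generator. *)
pose P t k := [exists T : {set 'I_N}, [&& B T, (code T < t)%N & (indicator T <= k)%MM]].
have upP t k k' : P t k -> P t (k + k')%MM.
  case/existsP => T /and3P[BT Tt Tk]; apply/existsP; exists T.
  by rewrite BT Tt (lepm_trans Tk) ?lem_addr.
suff h t : has_linear_resolution c (monomial_ideal (P t)).
  apply: eq_has_linear_resolution (h (code setT).+1); apply: eq_monomial_ideal => k.
  apply: eq_existsb => T; rewrite ltnS; congr (_ && _).
  by rewrite /code [X in (_ <= X)%N](big_setID T) /= setTI leq_addr.
elim: t => [|t IH].
  by apply: linear_resolution_pred0 => k; apply/existsP => -[T]; rewrite andbF.
case: (pickP (fun U => B U && (code U == t))) => [U /andP[BU /eqP Ut]|noU]; last first.
  apply: eq_has_linear_resolution IH; apply: eq_monomial_ideal => k.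
  apply: eq_existsb => T; rewrite ltnS [(code T <= t)%N]leq_eqVlt.
  by case: (boolP (B T)) => //= BT; move: (noU T); rewrite BT /= => ->.
have uniqU T : B T -> code T = t -> T = U.
  move=> BT Tt; case: (eqVneq T U) => // TU.
  have [|p [pU pT hv]] := code_leq_exists TU _; first by rewrite Tt Ut.
  by have := code_lt pU pT hv; rewrite Tt Ut ltnn.
have hadd := @has_linear_resolution_add_monomial c (P t) (indicator U) (@upP t) _ IH.
apply: eq_has_linear_resolution (hadd _ _) => [||].
- apply: eq_monomial_ideal => k; apply/orP/existsP => [[/existsP [T /and3P[BT Tt Tk]]|Uk]|].
  + by exists T; rewrite BT Tk ltnS ltnW.
  + by exists U; rewrite BU Ut ltnSn.
  case=> T /and3P[BT]; rewrite ltnS leq_eqVlt => /orP[/eqP Tt|Tt] Tk.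
    by right; rewrite -(uniqU T).
  by left; apply/existsP; exists T; rewrite BT Tt.
- by rewrite mdeg_indicator Bc.
(* The variables generating the colon of [P t] by the monomial of [U]: for such a [v], an earlier
   basis [v |: U :\ p] has a monomial dividing [v] times that of [U]. *)
pose V := [set v | (v \notin U) &&
  [exists p in U, B (v |: U :\ p) && (code (v |: U :\ p) < t)%N]].
apply: eq_has_linear_resolution (has_linear_resolution_variables V).
apply: eq_monomial_ideal => k; apply/exists_inP/existsP => [[v]|[T /and3P[BT Tt Tk]]].
  rewrite inE => /andP[vU /exists_inP [p pU /andP[BW Wt]]] kv.
  exists (v |: U :\ p); rewrite BW Wt indicator_leP; apply/forall_inP => i.
  rewrite !inE mnmDE mnmE => /orP[/eqP ->|/andP[_ ->]].
    by rewrite addn_gt0 kv.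
  by rewrite addn1.
(* Conversely, if an earlier [T] divides [k] times [U], exchanging the largest differing element [p]
   gives [v] in [T] outside [U]; so [k] itself contains [v], and [v < p] lowers the code. *)
have TU : T != U by apply: contraTneq Tt => ->; rewrite Ut ltnn.
have [|p [pU pT hv]] := code_leq_exists TU _; first by rewrite Ut ltnW.
have [v [vT vU BW]] := exB _ _ _ BT BU pU pT.
exists v; last first.
  have := mnm_lepP Tk v; rewrite mnmDE !mnmE vT (negbTE vU).
  by rewrite addn0.
rewrite inE vU; apply/exists_inP; exists p => //; rewrite BW -Ut.
apply: (code_lt pU); first by rewrite !inE eqxx /= orbF; apply: contraNneq pT => ->.
move=> w; rewrite !inE => /orP[/eqP -> _|/andP[_ ->] //].
exact: hv.
Qed.

End MonomialIdeals.

(** * Generated ideals, and regularity from a linear resolution *)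

Lemma ideal_generatedMl (R : comNzRingType) (G : R -> Prop) (a f : R) :
  ideal_generated G f -> ideal_generated G (a * f).
Proof.
case=> s [b [g [hg ->]]]; exists s, (fun i => a * b i), g; split=> //.
by rewrite mulr_sumr; apply: eq_bigr => i _; rewrite mulrA.
Qed.

Lemma ideal_generated_gen (R : comNzRingType) (G : R -> Prop) (f : R) :
  G f -> ideal_generated G f.
Proof. by exists 1%N, (fun=> 1), (fun=> f); rewrite big_ord1 mul1r. Qed.

Lemma ideal_generated_sum (R : comNzRingType) (G : R -> Prop) (I : eqType)
    (r : seq I) (F : I -> R) :
  (forall i, i \in r -> ideal_generated G (F i)) ->
  ideal_generated G (\sum_(i <- r) F i).
Proof.
elim: r => [_|x r IH hr].
  by exists 0%N, (fun=> 0), (fun=> 0); rewrite big_nil big_ord0; split=> // -[].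
have [s [a [g [hg rE]]]] : ideal_generated G (\sum_(i <- r) F i).
  by apply: IH => i ir; apply: hr; rewrite inE ir orbT.
have [s' [a' [g' [hg' xE]]]] := hr x (mem_head _ _).
exists (s' + s)%N, (fun i => match split i with inl j => a' j | inr j => a j end),
  (fun i => match split i with inl j => g' j | inr j => g j end).
split; first by move=> i; case: split.
rewrite big_cons xE rE big_split_ord /=; congr (_ + _); apply: eq_bigr => i _.
  by rewrite (unsplitK (inl i : 'I_s' + 'I_s)).
by rewrite (unsplitK (inr i : 'I_s' + 'I_s)).
Qed.

Lemma monomial_ideal_generated (K : fieldType) (N : nat) (P : pred 'X_{1..N})
    (G : {mpoly K[N]} -> Prop) (f : {mpoly K[N]}) :
  (forall k k', P k -> P (k + k')%MM) -> (forall g, G g -> monomial_ideal P g) ->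
  ideal_generated G f -> monomial_ideal P f.
Proof.
move=> upP hG [s [a [g [hg ->]]]]; apply: monomial_ideal_sum => i.
apply: (@monomial_idealM _ _ predT P) (hG _ (hg i)) => // k k' _ hk.
by rewrite addmC upP.
Qed.

Lemma irrelevant_ideal_degree1 (K : fieldType) (N : nat) (p : {mpoly K[N]}) :
  in_degree 1 p -> irrelevant_ideal p.
Proof.
move=> /in_degreeP hp; rewrite [p]mpolyE; apply: ideal_generated_sum => k /hp [hk].
rewrite -mul_mpolyC; apply: ideal_generatedMl; apply: ideal_generated_gen.
by have /eqP /mdeg1P [i /eqP ->] := hk; exists i.
Qed.

(** Consecutive shifts differ by one, so all entries of the differentials are linear forms. *)
Lemma linear_resolution_minimal (K : fieldType) (N : nat) c
    (F : graded_free_data K N) M :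
  linear_resolution c F M -> is_minimal_graded_free_resolution F M.
Proof.
move=> [rF gF]; split=> // k i j; apply: irrelevant_ideal_degree1.
by have := gfr_diff_graded rF i j; rewrite !gF; congr in_degree; lia.
Qed.

(** By [minimal_shifts_linear] every shift minus its homological degree is [c]; the nonzero [f]
    ensures that [F_0] has a basis vector, so the maximum is attained. *)
Lemma regularity_of_linear_resolution (K : fieldType) (N : nat) c
    (M : {mpoly K[N]} -> Prop) (f : {mpoly K[N]}) :
  has_linear_resolution c M -> M f -> f != 0 -> regularity_is M c.
Proof.
move=> [G lG] Mf f0; split; first by exists G; apply: linear_resolution_minimal lG.
move=> F mF; have sF := minimal_shifts_linear lG mF.
split=> [|k i]; last by rewrite sF addrK.
have /(gfr_image (proj1 mF)) [v vE] := Mf.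
case: (posnP (gf_rank F 0)) => [r0|r0].
  move: f0; rewrite -vE mxE big1 ?eqxx // => -[j jr] _.
  by exfalso; rewrite r0 in jr.
by exists 0%N, (Ordinal r0); rewrite sF addrK.
Qed.

(** * The product ideal as the ideal of the bases of a matroid *)

Section SquareFree.
Variables (K : fieldType) (n m : nat).
Implicit Types (T U : {set 'I_(n + m)}).

Definition xpart T : {set 'I_n} := [set i | lshift m i \in T].
Definition ypart T : {set 'I_m} := [set j | rshift n j \in T].

Definition bibasis q r T := (#|xpart T| == q) && (#|ypart T| == r).

Lemma card_xypart T : #|T| = (#|xpart T| + #|ypart T|)%N.
Proof.
rewrite -!sum1_card big_mkcond big_split_ord /= -!big_mkcond /=.
by congr (_ + _)%N; apply: eq_bigl => i; rewrite inE.
Qed.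

Lemma card_exchange (I : finType) (A : {set I}) (p v : I) :
  p \in A -> v \notin A -> #|v |: A :\ p| = #|A|.
Proof. by move=> pA vA; rewrite cardsU1 !inE (negbTE vA) andbF [RHS](cardsD1 p) pA. Qed.

Lemma exists_setD (I : finType) (A A' : {set I}) (p : I) :
  #|A| = #|A'| -> p \in A' -> p \notin A -> exists2 v, v \in A & v \notin A'.
Proof.
move=> AA' pA' pA; apply/exists_inP; apply: contraNT pA => h.
suff /eqP -> : A == A' by [].
rewrite eqEcard AA' leqnn andbT; apply/subsetP => v vA.
by apply: contraNT h => vA'; apply/exists_inP; exists v.
Qed.

(** Within the block of variables containing [p], both bases have equally many elements, so [v]
    exists in the same block and the other block is untouched. *)
Lemma bibasis_exchange q r : basis_exchange (bibasis q r).
Proof.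
move=> T U p /andP[/eqP Tq /eqP Tr] /andP[/eqP Uq /eqP Ur].
case: (splitP p) => [a|b] pE.
  have -> : p = lshift m a by apply: val_inj.
  move=> aU aT; have [v] : exists2 v, v \in xpart T & v \notin xpart U.
    by apply: (@exists_setD _ _ _ a); rewrite ?inE ?Tq.
  rewrite !inE => vT vU.
  exists (lshift m v); split=> //; apply/andP; split.
    rewrite -Uq -(@card_exchange _ (xpart U) a v) ?inE //; apply/eqP; congr #|pred_of_set _|.
    by apply/setP => i; rewrite !inE !(inj_eq (@lshift_inj _ _)).
  rewrite -Ur; apply/eqP; congr #|pred_of_set _|.
  by apply/setP => i; rewrite !inE !eq_rlshift.
have -> : p = rshift n b by apply: val_inj.
move=> bU bT; have [v] : exists2 v, v \in ypart T & v \notin ypart U.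
  by apply: (@exists_setD _ _ _ b); rewrite ?inE ?Tr.
rewrite !inE => vT vU.
exists (rshift n v); split=> //; apply/andP; split.
  rewrite -Uq; apply/eqP; congr #|pred_of_set _|.
  by apply/setP => i; rewrite !inE !eq_lrshift.
rewrite -Ur -(@card_exchange _ (ypart U) b v) ?inE //; apply/eqP; congr #|pred_of_set _|.
by apply/setP => i; rewrite !inE !(inj_eq (@rshift_inj _ _)).
Qed.

Definition bibasis_monomials q r (k : 'X_{1..n + m}) :=
  [exists T, bibasis q r T && (indicator T <= k)%MM].

Lemma bibasis_monomials_up q r k k' :
  bibasis_monomials q r k -> bibasis_monomials q r (k + k')%MM.
Proof.
case/exists_inP => T BT Tk; apply/exists_inP; exists T => //.
by rewrite (lepm_trans Tk) ?lem_addr.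
Qed.

Lemma mpolyX_indicator T : 'X_[indicator T] =
  (\prod_(i in xpart T) 'X_(lshift m i)) *
  (\prod_(j in ypart T) 'X_(rshift n j)) :> {mpoly K[n + m]}.
Proof.
rewrite mpolyXE_id big_split_ord /= [in RHS]big_mkcond [X in _ = _ * X]big_mkcond /=.
by congr (_ * _); apply: eq_bigr => i _; rewrite inE mnmE; case: in_mem.
Qed.

Lemma msupp_prodX_gt0 (I : finType) (g : I -> 'I_(n + m)) (A : {set I}) k :
  k \in msupp (\prod_(i in A) 'X_(g i) : {mpoly K[n + m]}) ->
  forall i, i \in A -> (0 < k (g i))%N.
Proof.
rewrite -(big_morph (fun k => 'X_[k]) (@mpolyXD _ K) (mpolyX0 _ K)) msuppX inE => /eqP -> i iA.
by rewrite mnm_sumE (bigD1 i) //= mnm1E eqxx.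
Qed.

Lemma ideal_product_sqfree q r f :
  monomial_ideal (bibasis_monomials q r) f <->
  ideal_product (@sqfree_ideal_x K n m q) (@sqfree_ideal_y K n m r) f.
Proof.
split=> [hf|].
  rewrite [f]mpolyE; apply: ideal_generated_sum => k /hf.
  case/exists_inP => T /andP[/eqP Tq /eqP Tr] Tk.
  rewrite -(submK Tk) mpolyXD scalerAl; apply: ideal_generatedMl.
  apply: ideal_generated_gen; rewrite mpolyX_indicator.
  by do 2!eexists; split; last reflexivity; apply: ideal_generated_gen;
    [exists (xpart T)|exists (ypart T)].
apply: monomial_ideal_generated => [k k'|_ [g [h [hg hh ->]]]].
  exact: bibasis_monomials_up.
(* Exponents divisible by some generator of the first factor; [Py] does the same for the second. *)
pose Px (k : 'X_{1..n + m}) :=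
  [exists A : {set 'I_n}, (#|A| == q) && [forall i in A, 0 < k (lshift m i)]%N].
pose Py (k : 'X_{1..n + m}) :=
  [exists A : {set 'I_m}, (#|A| == r) && [forall i in A, 0 < k (rshift n i)]%N].
have {}hg : monomial_ideal Px g.
  apply: monomial_ideal_generated hg => [k k'|_ [A Aq ->] k kA].
    case/exists_inP => A Aq /forall_inP hA; apply/exists_inP; exists A => //.
    by apply/forall_inP => i /hA; rewrite mnmDE addn_gt0 => ->.
  apply/exists_inP; exists A; first exact/eqP.
  by apply/forall_inP => i; apply: (msupp_prodX_gt0 (g := lshift m)).
have {}hh : monomial_ideal Py h.
  apply: monomial_ideal_generated hh => [k k'|_ [A Ar ->] k kA].
    case/exists_inP => A Ar /forall_inP hA; apply/exists_inP; exists A => //.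
    by apply/forall_inP => i /hA; rewrite mnmDE addn_gt0 => ->.
  apply/exists_inP; exists A; first exact/eqP.
  by apply/forall_inP => i; apply: (msupp_prodX_gt0 (g := @rshift n m)).
apply: monomial_idealM hg hh => k k' /exists_inP [A /eqP Aq /forall_inP hA].
case/exists_inP => A' /eqP A'r /forall_inP hA'; apply/exists_inP.
(* The two blocks of variables are disjoint, so the union has parts exactly [A] and [A']. *)
exists ((lshift m @: A) :|: (@rshift n m @: A')).
  apply/andP; split; apply/eqP; [rewrite -Aq|rewrite -A'r]; congr #|pred_of_set _|;
    apply/setP => i; rewrite !inE.
    rewrite mem_imset; last exact: lshift_inj.
    by case: imsetP => [[j _ /eqP]|]; rewrite ?eq_lrshift ?orbF.
  rewrite orbC mem_imset; last exact: rshift_inj.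
  by case: imsetP => [[j _ /eqP]|]; rewrite ?eq_rlshift ?orbF.
rewrite indicator_leP; apply/forall_inP => i; rewrite mnmDE addn_gt0.
rewrite inE => /orP[] /imsetP [j jA ->]; first by rewrite hA.
by rewrite hA' // orbT.
Qed.

(** The bounds on [q] and [r] enter here: they provide a generator, so that the product ideal is
    nonzero. *)
Lemma exists_bibasis q r : (q <= n)%N -> (r <= m)%N -> exists T, bibasis q r T.
Proof.
move=> qn rm; exists [set i | match split i with inl a => (a < q)%N | inr b => (b < r)%N end].
have card_lt (a b : nat) : (a <= b)%N -> #|[set i : 'I_b | (i < a)%N]| = a.
  by move=> ab; rewrite -sum1dep_card (big_ord_narrow ab) sum_nat_const card_ord muln1.
apply/andP; split; apply/eqP; [rewrite -{2}(card_lt q n)|rewrite -{2}(card_lt r m)] => //;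
  congr #|pred_of_set _|; apply/setP => i; rewrite !inE.
  by rewrite (unsplitK (inl i : 'I_n + 'I_m)).
by rewrite (unsplitK (inr i : 'I_n + 'I_m)).
Qed.

End SquareFree.

Theorem lemma2p5 (K : fieldType) (n m q r : nat)
    (hq : (q <= n)%N) (hr : (r <= m)%N) :
  regularity_is
    (ideal_product (@sqfree_ideal_x K n m q) (@sqfree_ideal_y K n m r))
    (Posz (q + r)%N).
Proof.
have [T BT] := exists_bibasis hq hr.
apply: (@regularity_of_linear_resolution _ _ _ _ 'X_[indicator T]).
- apply: eq_has_linear_resolution (@ideal_product_sqfree K n m q r) _.
  apply: has_linear_resolution_bases; last exact: bibasis_exchange.
  by move=> U /andP[/eqP <- /eqP <-]; apply: card_xypart.
- apply/ideal_product_sqfree => k; rewrite msuppX inE => /eqP ->.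
  by apply/exists_inP; exists T; rewrite ?lepm_refl.
by rewrite -msupp_eq0 msuppX.
Qed.
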